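(* Let $I$ be a finite set, and let $\{L_i\}_{i\in I}$ and $\{M_i\}_{i\in I}$ be collections of (nonempty) affine subspaces of finite-dimensional real vector spaces $L$ and $M$ respectively, with unions $X=\bigcup_{i\in I}L_i$ and $Y=\bigcup_{i\in I}M_i$ and nerves $K_X$ and $K_Y$. Then: (i) if a map $f\colon X\to Y$ compatible with $K_X$ and $K_Y$ exists, then $K_X\ge K_Y$; (ii) if a map $f\colon X\to Y$ compatible with $K_X$ and $K_Y$ exists, then it is unique up to homotopy; (iii) if $K_X$ is isomorphic to $K_Y$, then the map $f\colon X\to Y$ compatible with $K_X$ and $K_Y$ is a homotopy equivalence between $X$ and $Y$.
   Context: The nerve $K_X$ of the covering of $X$ by the $L_i$ is the simplicial complex with one vertex $v_i$ for each $i\in I$, in which $v_{i_1},\ldots,v_{i_k}$ form a simplex if and only if $L_{i_1}\cap\cdots\cap L_{i_k}\ne\varnothing$; $K_Y$ is defined in the same way from the $M_i$. $K_X$ dominates $K_Y$, written $K_X\ge K_Y$, if for any $J\subset I$, $\bigcap_{j\in J}L_j\neq\varnothing$ implies $\bigcap_{j\in J}M_j\ne\varnothing$. A continuous map $f\colon X\to Y$ is compatible with $K_X$ and $K_Y$ if $x\in L_{i_1}\cap\cdots\cap L_{i_k}$ implies $f(x)\in M_{i_1}\cap\cdots\cap M_{i_k}$. $K_X$ and $K_Y$ are isomorphic in the sense that they are equivalent ($K_X\ge K_Y$ and $K_Y\ge K_X$), i.e. $v_i\mapsto v_i$ is an isomorphism. *)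

(* Defs.v *)
From HB Require Import structures.
From mathcomp Require Import all_boot all_order all_algebra.
From mathcomp Require Import all_classical all_reals all_analysis.

Set Implicit Arguments.
Unset Strict Implicit.
Unset Printing Implicit Defensive.

Import Order.TTheory GRing.Theory Num.Theory.
Import numFieldNormedType.Exports.
Local Open Scope classical_set_scope.
Local Open Scope ring_scope.

(* [vectType R] carries no topology in the library.  [vtop V] is [V] with the
   topology pulled back from R^n along the coordinate map of a basis: it is the
   standard topology of a finite-dimensional real vector space, and does not
   depend on the basis. *)
Definition vtop (R : realType) (V : vectType R) : topologicalType :=
  initial_topology (passmx.rVof (vbasis {:V})).

(* Affine subspaces are nonempty: each is a translate of a linear subspace. *)
Definition affine_subspace (R : realType) (V : vectType R) (A : set V) :=
  exists (v : V) (U : {vspace V}), A = [set v + u | u in [set` U]].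

(* A map A -> B is a function on the ambient types; its values outside A are
   irrelevant. *)
Definition cont_map (T U : topologicalType) (A : set T) (B : set U)
    (f : T -> U) :=
  set_fun A B f /\ {within A, continuous f}.

Definition homotopic (R : realType) (T U : topologicalType)
    (A : set T) (B : set U) (f g : T -> U) :=
  exists2 H : T * R -> U,
    cont_map (A `*` `[0, 1] : set (T * R)%type) B H &
    forall x, A x -> H (x, 0) = f x /\ H (x, 1) = g x.

Definition homotopy_equivalence (R : realType) (T U : topologicalType)
    (A : set T) (B : set U) (f : T -> U) :=
  cont_map A B f /\
  exists g : U -> T,
    [/\ cont_map B A g,
        homotopic R A A (g \o f) idfun &
        homotopic R B B (f \o g) idfun].

Section Nerve.
Context (I : finType).

(* Simplices are identified with their sets of vertices.  The empty set is
   included as the empty simplex, since \bigcap over the empty family is the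
   whole ambient type. *)
Definition nerve (T : Type) (A : I -> set T) : set {set I} :=
  [set J | \bigcap_(j in [set` J]) A j !=set0].

Definition dominates (K K' : set {set I}) := forall J, K J -> K' J.

Definition nerve_iso (K K' : set {set I}) := dominates K K' /\ dominates K' K.

Definition compatible (T U : topologicalType)
    (A : I -> set T) (B : I -> set U) (f : T -> U) :=
  cont_map (\bigcup_i A i) (\bigcup_i B i) f /\
  forall (J : {set I}) (x : T),
    (\bigcap_(j in [set` J]) A j) x -> (\bigcap_(j in [set` J]) B j) (f x).

End Nerve.

(* Main.v *)
Require Import Defs.
From HB Require Import structures.
From mathcomp Require Import all_boot all_order all_algebra.
From mathcomp Require Import all_classical all_reals all_analysis.

(** Everything rests on the convexity of affine subspaces.

    Two maps compatible with the nerves send a point of [Ls i] into the same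
    affine subspace [Ms i], so the segment joining the two images stays in the
    union of the [Ms i]: the straight-line homotopy proves uniqueness
    ([compatible_homotopic]).

    When the nerve of the source dominates that of the target, a compatible map
    is given by one formula ([compatible_exists]).  Pick a point [m J] in the
    intersection of the [Ms j], [j] in [J], for each simplex [J] of the source
    nerve, and continuous functions [q i >= 0] vanishing exactly on [Ls i].  Let
    [f x] be the average of the points [m J] with weights proportional to the
    product of the [q i x] over the [i] outside [J].  If [x] lies on [Ls i], the
    weight of [m J] is zero unless [J] contains [i], so only points of [Ms i]
    are averaged and [f x] lies on [Ms i].  The weights do not all vanish at
    [x]: the [J] formed by all the [i] with [x] on [Ls i] is a simplex, and its
    weight is positive.

    If the nerves are isomorphic, there is also a compatible map [g] in the
    other direction.  Both composites with [f] are compatible with a covering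
    and itself, as is the identity, so by uniqueness they are homotopic to the
    identity. *)

Set Implicit Arguments.
Unset Strict Implicit.
Unset Printing Implicit Defensive.

Import Order.TTheory GRing.Theory Num.Theory.
Import numFieldNormedType.Exports.
Import passmx.
Local Open Scope classical_set_scope.
Local Open Scope ring_scope.

(** * The topology of a finite-dimensional space *)

Section VectorTopology.
Context (R : realType) (V : vectType R).

Let coords (x : vtop V) : 'rV[R]_(\dim {:V}) := rVof (vbasis {:V}) x.

Lemma coords_continuous : continuous coords.
Proof. exact: initial_continuous. Qed.

Lemma cvg_vtop (T : Type) (F : set_system T) (FF : Filter F)
    (f : T -> vtop V) (l : vtop V) :
  coords \o f @ F --> coords l -> f @ F --> l.
Proof.
move=> cf; have FfF : Filter (f @ F) by exact: fmap_filter.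
apply/cvg_image => //.
  rewrite eqEsubset; split=> // r _.
  exists (vecof (vbasis {:V}) r) => //.
  by rewrite vecofK ?vbasisP.
move=> B /cf FB; exists (coords @^-1` B) => //.
rewrite eqEsubset; split=> [_ [x ? <-] //|r Br].
exists (vecof (vbasis {:V}) r) => /=.
  by rewrite /coords vecofK ?vbasisP.
by rewrite vecofK ?vbasisP.
Qed.

Lemma cvg_lincomb (T : Type) (F : set_system T) (FF : Filter F) (K : finType)
    (P : pred K) (w : K -> T -> R) (a : K -> R)
    (p : K -> T -> vtop V) (b : K -> vtop V) :
    (forall k, P k -> w k @ F --> a k) ->
    (forall k, P k -> p k @ F --> b k) ->
  (fun x => (\sum_(k | P k) w k x *: (p k x : V) : V) : vtop V) @ F -->
    ((\sum_(k | P k) a k *: (b k : V) : V) : vtop V).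
Proof.
move=> wa pb; apply: cvg_vtop.
have coords_comb (c : K -> R) (v : K -> V) :
    coords (\sum_(k | P k) c k *: v k : V) = \sum_(k | P k) c k *: coords (v k).
  rewrite /coords (linear_sum (rVof (vbasis {:V}))).
  by apply: eq_bigr => k _; rewrite linearZ.
rewrite coords_comb /comp; under eq_cvg do rewrite coords_comb.
apply: cvg_big => [|k Pk]; first exact: add_continuous.
apply: cvgZ; first exact: wa.
by apply: (cvg_comp _ _ (pb k Pk)); exact: coords_continuous.
Qed.

(** Expanding [x] on the basis makes [h x] a combination of fixed vectors whose
    coefficients are the coordinates of [x], continuous by definition of
    [vtop]. *)
Lemma linear_vtop_continuous (W : normedModType R) (h : {linear V -> W}) :
  continuous (h : vtop V -> W).
Proof.
have coord_cont j : continuous (fun x => coords x 0 j).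
  move=> x; have cx := @coord_continuous R 1 (\dim {:V}) 0 j (coords x).
  exact: (cvg_comp _ _ (@coords_continuous x) cx).
have -> : (h : vtop V -> W) =
    (fun x => \sum_j coords x 0 j *: h (vbasis {:V})`_j).
  apply/funext => x.
  rewrite {1}(coord_vbasis (memvf (x : V))) (linear_sum h).
  by apply: eq_bigr => j _; rewrite (linearZ_LR h) /coords mxE.
apply: (@continuous_big _ _ _ _ _ _ (vtop V)) => [|j _ x].
  exact: add_continuous.
exact: (@cvgZr_tmp _ _ (vtop V) (nbhs x) (nbhs_filter x) _ _ _ (coord_cont j x)).
Qed.

End VectorTopology.

(** * Affine subspaces *)

Section Affine.
Context (R : realType) (V : vectType R).

(** Points of weight zero are allowed to lie outside [A]: this is what lets
    the weights decide which of the chosen points matter. *)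
Lemma affine_comb (A : set V) (K : finType) (P : pred K) (w : K -> R)
    (p : K -> V) :
  affine_subspace A -> \sum_(k | P k) w k = 1 ->
  (forall k, P k -> w k != 0 -> A (p k)) ->
  A (\sum_(k | P k) w k *: p k).
Proof.
move=> [v [U ->]] w1 pA; exists (\sum_(k | P k) w k *: (p k - v)).
  apply: memv_suml => k Pk; have [->|wk0] := eqVneq (w k) 0.
    by rewrite scale0r mem0v.
  have [u uU <-] := pA k Pk wk0.
  by rewrite addrC addKr; exact: memvZ.
under eq_bigr do rewrite scalerBr.
by rewrite sumrB -scaler_suml w1 scale1r subrKC.
Qed.

(** If [A] is the translate by [v] of a linear subspace [U], a suitable [q x] is
    the coordinate norm of the component of [x - v] along a complement of
    [U]. *)
Lemma affine_zero_set (A : set (vtop V)) : affine_subspace (A : set V) ->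
  exists q : vtop V -> R,
    [/\ continuous q, forall x, 0 <= q x & forall x, A x <-> q x = 0].
Proof.
move=> [v [U ->]].
pose h := rVof (vbasis {:V}) \o (\1 - projv U)%VF.
have h0 (x : V) : h x = 0 <-> x \in U.
  rewrite /h /= add_lfunE opp_lfunE id_lfunE; split=> [|xU].
    move=> /(congr1 (vecof (vbasis {:V}))).
    rewrite rVofK ?vbasisP// linear0 => /eqP.
    by rewrite subr_eq0 => /eqP ->; exact: memv_proj.
  by rewrite projv_id// subrr linear0.
exists (fun x => `|h x - h v|); split=> [x|x|x].
- have ch := @linear_vtop_continuous _ _ _ h x.
  have Fx : Filter (nbhs (x : vtop V)) by exact: nbhs_filter.
  exact: (cvg_norm (cvgB ch (cvg_cst (h v)))).
- exact: normr_ge0.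
- have -> : `|h x - h v| = 0 <-> (x : V) - v \in U.
    by rewrite -h0 /h /= !linearB; split=> [/normr0_eq0|->]; rewrite ?normr0.
  split=> [[u uU <-]|xvU]; first by rewrite addrC addKr.
  by exists ((x : V) - v) => //; exact: subrKC.
Qed.

End Affine.

(** * Compatible maps *)

Section Compatible.
Context (I : finType).

(** The sets [J] with one element already carry the whole condition on
    intersections, as well as the inclusion of the image in the union. *)
Lemma compatibleP (T U : topologicalType) (A : I -> set T) (B : I -> set U)
    (f : T -> U) :
  compatible A B f <->
  {within \bigcup_i A i, continuous f} /\ (forall i, set_fun (A i) (B i) f).
Proof.
split=> [[[_ cf] fAB]|[cf fAB]].
  split=> // i x Aix.
  by apply: (fAB [set i]%SET x) => /= [j|]; rewrite /= inE// => /eqP ->.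
split; first by split=> // x [i _ Aix]; exists i => //; exact: fAB.
by move=> J x AJx j Jj; apply: fAB; exact: AJx.
Qed.

Lemma compatible_id (T : topologicalType) (A : I -> set T) :
  compatible A A idfun.
Proof.
apply/compatibleP; split=> [|i x //].
by apply/subspace_continuousP => x _; apply: cvg_within_filter; exact: cvg_id.
Qed.

Lemma compatible_comp (T U W : topologicalType) (A : I -> set T)
    (B : I -> set U) (C : I -> set W) (f : T -> U) (g : U -> W) :
  compatible A B f -> compatible B C g -> compatible A C (g \o f).
Proof.
move=> /compatibleP[/subspace_continuousP cf fAB].
move=> /compatibleP[/subspace_continuousP cg gBC].
apply/compatibleP; split=> [|i x Aix]; last exact/gBC/fAB.
apply/subspace_continuousP => x Xx.
have Yfx y : (\bigcup_i A i) y -> (\bigcup_i B i) (f y).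
  by move=> [i _ Aiy]; exists i => //; exact: fAB.
have cfw : f @ within (\bigcup_i A i) (nbhs x) -->
    within (\bigcup_i B i) (nbhs (f x)).
  move=> P nP; have : nbhs x _ := cf x Xx _ nP.
  by apply: filterS => y /= fyP Xy; apply: fyP => //; exact: Yfx.
exact: (cvg_comp _ _ cfw (cg _ (Yfx _ Xx))).
Qed.

Lemma compatible_dominates (T U : topologicalType) (A : I -> set T)
    (B : I -> set U) (f : T -> U) :
  compatible A B f -> dominates (nerve A) (nerve B).
Proof. by move=> [_ fAB] J [x AJx]; exists (f x); exact: fAB. Qed.

Lemma cvg_fst_within (T U : topologicalType) (A : set T) (B : set U)
    (z : T * U) :
  fst @ within (A `*` B) (nbhs z) --> within A (nbhs z.1).
Proof.
move: z => [x y] P nP; exists ([set x' | A x' -> P x'], setT) => /=.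
  by split=> //; exact: filterT.
by move=> [x' y'] /= [+ _] [] => /[apply].
Qed.

(** The straight-line homotopy is written as a sum over [bool], so that both
    [affine_comb] and [cvg_lincomb] apply to it. *)
Lemma compatible_homotopic (R : realType) (T : topologicalType)
    (V : vectType R) (A : I -> set T) (B : I -> set (vtop V))
    (f g : T -> vtop V) :
  (forall i, affine_subspace (B i : set V)) ->
  compatible A B f -> compatible A B g ->
  homotopic R (\bigcup_i A i) (\bigcup_i B i) f g.
Proof.
move=> affB /compatibleP[/subspace_continuousP cf fAB].
move=> /compatibleP[/subspace_continuousP cg gAB].
pose w (b : bool) (z : T * R) : R := if b then z.2 else 1 - z.2.
pose p (b : bool) (z : T * R) : vtop V := if b then g z.1 else f z.1.
exists (fun z => \sum_b w b z *: (p b z : V)); last first.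
  move=> x _; rewrite !big_bool /w /p /= subr0 subrr.
  by rewrite !scale0r !scale1r addr0 add0r.
split=> [[x t] [[i _ /= Aix] _]|].
  exists i => //; apply: affine_comb => //=.
    by rewrite big_bool /w /= subrKC.
  by case=> _ _; [exact: gAB|exact: fAB].
apply/subspace_continuousP => -[x t] [/= Xx _].
have cfst := @cvg_fst_within T R (\bigcup_i A i) `[0, 1] (x, t).
have csnd : snd @ within ((\bigcup_i A i) `*` `[0, 1]) (nbhs (x, t)) --> t.
  apply: (@cvg_within_filter _ _ _ _ (nbhs_filter ((x, t) : T * R))).
  exact: (@cvg_snd _ _ (nbhs x) (nbhs t) (nbhs_filter x)).
apply: cvg_lincomb => -[] _ //=; rewrite /w /p.
- by apply: cvgB => //; exact: cvg_cst.
- exact: (cvg_comp _ _ cfst (cg x Xx)).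
- exact: (cvg_comp _ _ cfst (cf x Xx)).
Qed.

(** Convexity matters only in the target: about the sources [A i] it is enough
    to know that they are zero sets of continuous nonnegative functions. *)
Lemma compatible_exists (R : realType) (T : topologicalType)
    (V : vectType R) (A : I -> set T) (B : I -> set (vtop V))
    (q : I -> T -> R) :
  (forall i, continuous (q i)) -> (forall i x, 0 <= q i x) ->
  (forall i x, A i x <-> q i x = 0) ->
  (forall i, affine_subspace (B i : set V)) ->
  dominates (nerve A) (nerve B) ->
  exists f : T -> vtop V, compatible A B f.
Proof.
move=> cq q_ge0 Aq affB domAB.
pose m (J : {set I}) : vtop V := xget (0 : V) (\bigcap_(j in [set` J]) B j).
have mB J : nerve A J -> (\bigcap_(j in [set` J]) B j) (m J).
  by move=> /domAB [y By]; apply: (xgetPex (0 : V)); exists y.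
pose w (J : {set I}) x := \prod_(i | i \notin J) q i x.
pose S x := \sum_(J | J \in nerve A) w J x.
have w_ge0 J x : 0 <= w J x by apply: prodr_ge0.
have S_gt0 x : 0 < S x.
  (* The weight of the simplex of all i with x in A i is positive. *)
  pose J := [set i | `[< A i x >]]%SET.
  have JA : J \in nerve A.
    by rewrite inE; exists x => j /=; rewrite inE => /asboolP.
  rewrite /S (bigD1 J) //=; apply: ltr_wpDr; first exact: sumr_ge0.
  apply: prodr_gt0 => i; rewrite inE => /asboolPn Aix.
  by rewrite lt_neqAle q_ge0 andbT eq_sym; apply/eqP => /Aq.
have cw J : continuous (w J).
  by apply: continuous_big => //; exact: mul_continuous.
have cS : continuous S by apply: continuous_big => //; exact: add_continuous.
exists (fun x => \sum_(J | J \in nerve A) (w J x / S x) *: (m J : V)).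
apply/compatibleP; split=> [|i x Aix].
  apply/subspace_continuousP => x _; apply: cvg_within_filter.
  apply: (@cvg_lincomb _ _ _ _ _ _ _ _ _ (fun J _ => m J)) => J _;
    last exact: cvg_cst.
  apply: cvgM; first exact: cw.
  by apply: cvgV; [rewrite gt_eqF// S_gt0|exact: cS].
apply: affine_comb => // [|J /set_mem JA].
  by rewrite -mulr_suml divff // gt_eqF ?S_gt0.
have [iJ _|iJ] := boolP (i \in J); first exact: mB.
by rewrite /w (bigD1 i) //= ((Aq i x).1 Aix) !mul0r eqxx.
Qed.

End Compatible.

Theorem theorem3p5 (R : realType) (I : finType) (L M : vectType R)
    (Ls : I -> set (vtop L)) (Ms : I -> set (vtop M))
    (affL : forall i, affine_subspace (Ls i : set L))
    (affM : forall i, affine_subspace (Ms i : set M)) :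
  let X := \bigcup_i Ls i in
  let Y := \bigcup_i Ms i in
  let KX := nerve Ls in
  let KY := nerve Ms in
  [/\ (exists f : vtop L -> vtop M, compatible Ls Ms f) -> dominates KX KY,
      forall f g : vtop L -> vtop M,
        compatible Ls Ms f -> compatible Ls Ms g -> homotopic R X Y f g
    & nerve_iso KX KY ->
        (exists f : vtop L -> vtop M, compatible Ls Ms f) /\
        (forall f : vtop L -> vtop M,
           compatible Ls Ms f -> homotopy_equivalence R X Y f)].
Proof.
move=> X Y KX KY; split=> [[f cf]|f g cf cg|[XY YX]].
- exact: compatible_dominates cf.
- exact: compatible_homotopic.
have ex_comp (V W : vectType R) (As : I -> set (vtop V))
    (Bs : I -> set (vtop W)) :
    (forall i, affine_subspace (As i : set V)) ->
    (forall i, affine_subspace (Bs i : set W)) ->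
    dominates (nerve As) (nerve Bs) -> exists f, compatible As Bs f.
  move=> affA affB; have [q Pq] := choice (fun i => affine_zero_set (affA i)).
  by apply: (compatible_exists (q := q)) => // i; have [] := Pq i.
split=> [|f cf]; first exact: ex_comp.
have [g cg] := ex_comp _ _ _ _ affM affL YX.
split; first by case: cf.
exists g; split; first by case: cg.
- apply: compatible_homotopic => //; last exact: compatible_id.
  exact: compatible_comp cf cg.
- apply: compatible_homotopic => //; last exact: compatible_id.
  exact: compatible_comp cg cf.
Qed.
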